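(* Suppose that (a) the grid $\mathbb{Z}^{g}$ satisfies $\mathrm{co}(\mathbb{Z}^{g})\supseteq f_s(\mathbb{X}^{d})$, and (b) the extension operator $\widetilde{[\cdot]}$ is non-expansive in the infinity-norm: for any two discrete functions $J_1^{d},J_2^{d}:\mathbb{X}^{d}\to\mathbb{R}$ with extensions $\widetilde{J_1^{d}},\widetilde{J_2^{d}}:\mathbb{X}\to\mathbb{R}$, one has $\|\widetilde{J_1^{d}}-\widetilde{J_2^{d}}\|_\infty\le\|J_1^{d}-J_2^{d}\|_\infty$. Then the d-CDP operator $\widehat{\mathcal{T}}^{d}$ is $\gamma$-contractive with respect to the infinity-norm, i.e. for all $J_1^{d},J_2^{d}:\mathbb{X}^{d}\to\mathbb{R}$, $$\|\widehat{\mathcal{T}}^{d}J_1^{d}-\widehat{\mathcal{T}}^{d}J_2^{d}\|_\infty\le\gamma\,\|J_1^{d}-J_2^{d}\|_\infty .$$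
   Context: Setting. $\mathbb{X}\subset\mathbb{R}^n$ (states) and $\mathbb{U}\subset\mathbb{R}^m$ (inputs) are compact; the disturbance $w$ has finite support $\mathbb{W}^{d}\subset\mathbb{R}^n$ with probability mass function $p:\mathbb{W}^{d}\to[0,1]$; $\gamma\in(0,1)$. The dynamics is $g(x,u,w)=f(x,u)+w$ with $f(x,u)=f_s(x)+Bu$, where $f_s:\mathbb{R}^n\to\mathbb{R}^n$ is Lipschitz and $B\in\mathbb{R}^{n\times m}$. The stage cost is $C(x,u)=C_s(x)+C_i(u)$ with $C_s:\mathbb{X}\to\mathbb{R}$ and $C_i:\mathbb{U}\to\mathbb{R}$ Lipschitz. $\mathbb{X}^{d}\subset\mathbb{X}$ and $\mathbb{U}^{d}\subset\mathbb{U}$ are finite sets, and for every $x\in\mathbb{X}^{d}$ the set $\mathbb{U}(x)=\{u\in\mathbb{U}: g(x,u,w)\in\mathbb{X}\ \forall w\in\mathbb{W}^{d}\}$ is nonempty. Notation. A grid is a Cartesian product of finite subsets of $\mathbb{R}$; $\mathbb{Y}^{g},\mathbb{Z}^{g}\subset\mathbb{R}^n$ and $\mathbb{V}^{g}\subset\mathbb{R}^m$ are grids. $\mathrm{co}$ denotes the convex hull and $\langle\cdot,\cdot\rangle$ the Euclidean inner product. For a real function $h$ on a grid, $\overline{h}$ denotes its LERP extension: multilinear interpolation of the values at the vertices of the grid cell containing the point, inside the convex hull of the grid, and multilinear extrapolation outside. $\widetilde{[\cdot]}$ is a given extension operator assigning to each $J^{d}:\mathbb{X}^{d}\to\mathbb{R}$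 a function $\widetilde{J^{d}}:\mathbb{X}\to\mathbb{R}$ (extended by $+\infty$ outside $\mathbb{X}$). $C_i^{d}$ is the restriction of $C_i$ to $\mathbb{U}^{d}$. The discrete conjugate dynamic programming (d-CDP) operator $\widehat{\mathcal{T}}^{d}$, acting on real-valued functions $J^{d}$ on $\mathbb{X}^{d}$ and returning real-valued functions on $\mathbb{X}^d$, is defined by - $\varepsilon^{d}(x)=\gamma\sum_{w\in\mathbb{W}^{d}}p(w)\,\widetilde{J^{d}}(x+w)$, $x\in\mathbb{X}^{d}$ (values in $\mathbb{R}\cup\{\infty\}$); - $\varepsilon^{d*d}(y)=\max_{x\in\mathbb{X}^{d}}\{\langle x,y\rangle-\varepsilon^{d}(x)\}$, $y\in\mathbb{Y}^{g}$; - $C_i^{d*d}(v)=\max_{u\in\mathbb{U}^{d}}\{\langle u,v\rangle-C_i^{d}(u)\}$, $v\in\mathbb{V}^{g}$; - $\varphi^{d}(y)=\overline{C_i^{d*d}}(-B^\top y)+\varepsilon^{d*d}(y)$, $y\in\mathbb{Y}^{g}$; - $\varphi^{d*d}(z)=\max_{y\in\mathbb{Y}^{g}}\{\langle y,z\rangle-\varphi^{d}(y)\}$, $z\in\mathbb{Z}^{g}$; - $\widehat{\mathcal{T}}^{d}J^{d}(x)=C_s(x)+\overline{\varphi^{d*d}}(f_s(x))$, $x\in\mathbb{X}^{d}$. *)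

(* Defs.v *)
From HB Require Import structures.
From mathcomp Require Import all_boot all_order all_algebra finmap.
From mathcomp Require Import all_classical all_reals all_analysis.

Set Implicit Arguments.
Unset Strict Implicit.
Unset Printing Implicit Defensive.

Import Order.TTheory GRing.Theory Num.Theory.
Import numFieldNormedType.Exports.

Local Open Scope classical_set_scope.
Local Open Scope fset_scope.
Local Open Scope ring_scope.

Section norms_and_hulls.
Context {R : realType}.

Definition inner (k : nat) (x y : 'cV[R]_k) : R := \sum_(i < k) x i 0 * y i 0.

(* Extended-real valued, since a function on an infinite set may be unbounded. *)
Definition sup_norm (T : Type) (A : set T) (h : T -> R) : \bar R :=
  ereal_sup [set `|h x|%:E | x in A].

Definition convex_hull (k : nat) (A : set 'cV[R]_k) : set 'cV[R]_k :=
  smallest (fun C => convex_set (C : set (convex_lmodType 'cV[R]_k))) A.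

End norms_and_hulls.

Section grids.
Context {R : realType}.

(* [G] stands for the Cartesian product of the [G i]. *)
Definition grid (k : nat) := 'I_k -> {fset R}.

Definition grid_points (k : nat) (G : grid k) : {fset 'cV[R]_k} :=
  [fset x in [seq \col_i val (t i) | t : {dffun forall i : 'I_k, G i}]].

(* The cell of [t] in a strictly increasing list [s] is
   [s_j, s_(j+1)] with j = cell_index s t. Points left (right) of all of [s]
   are attached to the first (last) cell, which is what makes [lerp] an
   extrapolation outside the hull of the grid. *)
Definition cell_index (s : seq R) (t : R) : nat :=
  minn (count (fun a => a <= t) s).-1 (size s).-2.

Definition axis (A : {fset R}) : seq R := sort <=%O (enum_fset A).

Definition cell_lo (A : {fset R}) (t : R) : R :=
  nth 0 (axis A) (cell_index (axis A) t).

(* If [A] is a singleton, the cell is degenerate: both ends are its point. *)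
Definition cell_hi (A : {fset R}) (t : R) : R :=
  nth (cell_lo A t) (axis A) (cell_index (axis A) t).+1.

(* In a degenerate cell this is _ / 0 = 0, hence [lerp] is constant along the
   corresponding coordinate. *)
Definition cell_weight (A : {fset R}) (t : R) : R :=
  (t - cell_lo A t) / (cell_hi A t - cell_lo A t).

(* The vertices of the cell of [x] are indexed by b : 'I_k -> bool. Only the
   values of [h] at points of the grid are used. *)
Definition lerp (k : nat) (G : grid k) (h : 'cV[R]_k -> R) (x : 'cV[R]_k) : R :=
  \sum_(b : {ffun 'I_k -> bool})
    (\prod_(i < k) (if b i then cell_weight (G i) (x i 0)
                    else 1 - cell_weight (G i) (x i 0))) *
    h (\col_i (if b i then cell_hi (G i) (x i 0) else cell_lo (G i) (x i 0))).

End grids.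

Section dconj.
Context {R : realType}.

(* The discrete conjugate max_(x in A) (<x, y> - h x). *)
Definition dconj (k : nat) (A : {fset 'cV[R]_k}) (h : 'cV[R]_k -> \bar R)
    (y : 'cV[R]_k) : \bar R :=
  (\big[maxe/-oo]_(x <- A) ((inner x y)%:E - h x))%E.

Lemma dconj_fin_num (k : nat) (A : {fset 'cV[R]_k}) (h : 'cV[R]_k -> \bar R)
    (y x0 : 'cV[R]_k) :
  (forall x, x \in A -> h x != -oo%E) -> x0 \in A -> h x0 \is a fin_num ->
  dconj A h y \is a fin_num.
Proof.
move=> hN x0A hx0.
rewrite fin_numElt; apply/andP; split; rewrite /dconj.
  apply: (@lt_le_trans _ _ ((inner x0 y)%:E - h x0)%E).
    by rewrite ltNye_eq fin_numB hx0.
  rewrite big_seq (big_rem x0)//= x0A le_max lexx//.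
rewrite big_seq; apply: (big_ind (fun z => (z < +oo)%E)) => //.
  by move=> a b aoo boo; rewrite gt_max aoo boo.
move=> x xA; have := hN x xA.
by case: (h x) => [r| |]//= _; rewrite ?ltry ?ltNyr.
Qed.

End dconj.

Section dCDP.
Context {R : realType} (n m : nat).

(* Values outside [X] are discarded. *)
Definition extend_pinfty (X : set 'cV[R]_n) (h : 'cV[R]_n -> R)
    (x : 'cV[R]_n) : \bar R :=
  if x \in X then (h x)%:E else +oo%E.

Variables (gamma : R) (fs : 'cV[R]_n -> 'cV[R]_n) (B : 'M[R]_(n, m)).
Variables (Cs : 'cV[R]_n -> R) (Ci : 'cV[R]_m -> R).
Variables (X : set 'cV[R]_n) (Xd : {fset 'cV[R]_n}) (Ud : {fset 'cV[R]_m}).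
Variables (Wd : {fset 'cV[R]_n}) (p : Wd -> R).
Variables (ext : (Xd -> R) -> ('cV[R]_n -> R)).
Variables (Yg Zg : @grid R n) (Vg : @grid R m).

Definition dynamics (x : 'cV[R]_n) (u : 'cV[R]_m) (w : 'cV[R]_n) : 'cV[R]_n :=
  fs x + B *m u + w.

Definition admissible_inputs (U : set 'cV[R]_m) (x : 'cV[R]_n) :
    set 'cV[R]_m :=
  [set u | U u /\ forall w, w \in Wd -> X (dynamics x u w)].

(* Recall 0 * +oo = 0 in \bar R: a [w] of probability zero does not matter. *)
Definition epsd (J : Xd -> R) (x : 'cV[R]_n) : \bar R :=
  (gamma%:E * \sum_(w : Wd) (p w)%:E * extend_pinfty X (ext J) (x + val w))%E.

Definition phid (J : Xd -> R) (y : 'cV[R]_n) : \bar R :=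
  ((lerp Vg (fun v => fine (dconj Ud (EFin \o Ci) v)) (- (B^T *m y)))%:E
   + dconj Xd (epsd J) y)%E.

(* [fine] turns the extended-real maxima into real numbers. They are finite as
   soon as [Ud] and the grid [Yg] are nonempty and [epsd J] is finite at some
   point of [Xd], see [dconj_fin_num] and [phidd_fin_num]. *)
Definition dCDP (J : Xd -> R) : Xd -> R := fun x =>
  Cs (val x)
  + lerp Zg (fun z => fine (dconj (grid_points Yg) (phid J) z)) (fs (val x)).

Lemma phidd_fin_num (J : Xd -> R) (x0 y0 z : 'cV[R]_n) :
  0 <= gamma -> (forall w, 0 <= p w) ->
  x0 \in Xd -> epsd J x0 \is a fin_num -> y0 \in grid_points Yg ->
  dconj (grid_points Yg) (phid J) z \is a fin_num.
Proof.
move=> g0 p0 x0X ex0 y0Y.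
have mulN (a : R) (e : \bar R) : 0 <= a -> e != -oo%E ->
    (a%:E * e)%E != -oo%E.
  rewrite le_eqVlt => /predU1P[<- _|a0]; first by rewrite mul0e.
  by case: e => [r| |]// _; rewrite gt0_muley.
have epsN x : epsd J x != -oo%E.
  apply: (mulN) => //; apply: (big_ind (fun e => e != -oo%E)) => //.
    by move=> [a| |] [b| |].
  by move=> w _; apply: (mulN); rewrite // /extend_pinfty; case: ifP.
have phiF y : phid J y \is a fin_num.
  by rewrite fin_numD /= (@dconj_fin_num _ _ _ _ _ x0).
apply: (@dconj_fin_num _ _ _ _ _ y0) => // y _.
by have := phiF y; rewrite fin_numE => /andP[].
Qed.

End dCDP.

(* Main.v *)
(* At a point of the hull of the grid, LERP is a convex combination of values at
   grid points, hence non-expansive. Discrete conjugation turns a bound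
   h2 <= h1 + d into h1^* <= h2^* + d, and the expectation with discount turns
   d into gamma * d. The bounds are kept one-sided in the extended reals, so
   that infinite values need no separate treatment. *)

Require Import Defs.
From HB Require Import structures.
From mathcomp Require Import all_boot all_order all_algebra finmap.
From mathcomp Require Import zify lra.
From mathcomp Require Import all_classical all_reals all_analysis.

Import Order.TTheory GRing.Theory Num.Theory.
Import numFieldNormedType.Exports.

Local Open Scope classical_set_scope.
Local Open Scope fset_scope.
Local Open Scope ring_scope.

Lemma count_gt0 (T : eqType) (P : pred T) (s : seq T) (a : T) :
  a \in s -> P a -> (0 < count P s)%N.
Proof. by move=> sa Pa; rewrite -has_count; apply/hasP; exists a. Qed.

(** [a] makes [count (<= t)] positive, so the index stays below it and the lower end is at most [t].
    [b] makes [count (< t)] less than the size, so the next index, even when clamped to the last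
    entry, is at least [count (< t)]. *)
Lemma cell_bounds (R : realType) (A : {fset R}) (a b t : R) :
  a \in A -> b \in A -> a <= t <= b -> cell_lo A t <= t <= cell_hi A t.
Proof.
move=> aA bA /andP[at_ tb].
have sA : sorted <=%O (axis A) by exact: sort_le_sorted.
have as_ : a \in axis A by rewrite mem_sort.
have bs : b \in axis A by rewrite mem_sort.
have c_gt0 : (0 < count (<= t) (axis A))%N by exact: count_gt0 as_ at_.
have cn := count_size (<= t) (axis A).
have ltn_size : (count (< t) (axis A) < size (axis A))%N.
  rewrite -(count_predC (< t)) -[X in (X < _)%N]addn0 ltn_add2l.
  by apply: count_gt0 bs _; rewrite /= -leNgt.
have ltle : (count (< t) (axis A) <= count (<= t) (axis A))%N.
  by apply: sub_count => x; exact: ltW.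
have jE : cell_index (axis A) t =
    minn (count (<= t) (axis A)).-1 (size (axis A)).-2 by [].
have lo_t : cell_lo A t <= t.
  by apply: nth_count_le => //; rewrite jE; lia.
(* On a one-point axis the default of [nth] makes [cell_hi] equal to [cell_lo], and no entry lies
   strictly below [t]. *)
rewrite lo_t /=; have [s1|s_gt1] := leqP (size (axis A)) 1.
  rewrite /cell_hi nth_default ?(leq_trans s1)// /cell_lo.
  have jb : (count (< t) (axis A) <= cell_index (axis A) t
      < size (axis A))%N by rewrite jE; lia.
  exact: nth_count_ge.
have jb : (count (< t) (axis A) <= (cell_index (axis A) t).+1
    < size (axis A))%N by rewrite jE; lia.
exact: nth_count_ge.
Qed.

(* The case of equal ends relies on _ / 0 = 0. *)
Lemma cell_weight_itv (R : realType) (A : {fset R}) (t : R) :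
  cell_lo A t <= t <= cell_hi A t -> 0 <= cell_weight A t <= 1.
Proof.
move=> /andP[lot thi]; rewrite /cell_weight.
rewrite divr_ge0 ?subr_ge0 ?(le_trans lot)//=.
have [->|lohi] := eqVneq (cell_hi A t) (cell_lo A t).
  by rewrite subrr invr0 mulr0.
rewrite ler_pdivrMr ?mul1r ?lerB// subr_gt0 lt_neqAle eq_sym lohi.
exact: le_trans thi.
Qed.

(** The points whose coordinate [i] is enclosed by two entries of [G i] form a convex set containing
    the grid, and the hull is the smallest such set. *)
Lemma convex_hull_grid (R : realType) (k : nat) (G : @grid R k) (x : 'cV[R]_k)
    (i : 'I_k) :
  convex_hull [set z | z \in grid_points G] x ->
  exists a b, [/\ a \in G i, b \in G i & a <= x i 0 <= b].
Proof.
pose C : set 'cV[R]_k :=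
  [set y | exists a b, [/\ a \in G i, b \in G i & a <= y i 0 <= b]].
suff: (convex_hull [set z | z \in grid_points G] `<=` C)%classic by apply.
apply: smallest_sub.
- move=> y z t; rewrite !inE => -[a [b [aG bG /andP[ay yb]]]].
  move=> -[a' [b' [aG' bG' /andP[az zb]]]].
  exists (Num.min a a'), (Num.max b b'); split.
  + by case: leP.
  + by case: leP.
  have t0 : 0 <= t%:num by [].
  have t1 : 0 <= 1 - t%:num by rewrite subr_ge0.
  have tE : t%:num + (1 - t%:num) = 1 by rewrite addrC subrK.
  rewrite /conv/= !mxE; apply/andP; split.
    rewrite -[leLHS]mul1r -tE mulrDl.
    by rewrite lerD ?ler_wpM2l// ge_min ?ay ?az ?orbT.
  rewrite -[leRHS]mul1r -[X in _ <= X * _]tE [leRHS]mulrDl.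
  by rewrite lerD ?ler_wpM2l// le_max ?yb ?zb ?orbT.
- move=> y /=; rewrite /grid_points !inE => /mapP[t _ ->].
  by exists (val (t i)), (val (t i)); rewrite !mxE lexx !fsvalP.
Qed.

Lemma lerp_nonexpansive (R : realType) (k : nat) (G : @grid R k)
    (h1 h2 : 'cV[R]_k -> R) (d : R) (x : 'cV[R]_k) :
  convex_hull [set z | z \in grid_points G] x ->
  (forall z, `|h1 z - h2 z| <= d) -> `|lerp G h1 x - lerp G h2 x| <= d.
Proof.
move=> xG h12.
(* This is where lying in the hull enters: extrapolation could give weights outside [0, 1]. *)
have w01 i : 0 <= cell_weight (G i) (x i 0) <= 1.
  have [a [b [aG bG axb]]] := convex_hull_grid _ _ _ _ i xG.
  by apply: cell_weight_itv; exact: cell_bounds aG bG axb.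
pose w (b : {ffun 'I_k -> bool}) := \prod_(i < k)
  (if b i then cell_weight (G i) (x i 0) else 1 - cell_weight (G i) (x i 0)).
have w_ge0 b : 0 <= w b.
  apply: prodr_ge0 => i _; have /andP[w0 w1] := w01 i.
  by case: ifP => // _; rewrite subr_ge0.
have w_sum : \sum_b w b = 1.
  (* Distributivity folds the sum over vertices into a product over coordinates of weight + (1 -
     weight) = 1. *)
  rewrite -(bigA_distr_bigA (fun i (c : bool) =>
    if c then cell_weight (G i) (x i 0) else 1 - cell_weight (G i) (x i 0))).
  by apply: big1 => i _; rewrite big_bool/= addrC subrK.
rewrite /lerp -sumrB (le_trans (ler_norm_sum _ _ _))//.
rewrite -[leRHS]mul1r -[X in _ <= X * _]w_sum mulr_suml; apply: ler_sum => b _.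
by rewrite -mulrBr normrM (ger0_norm (w_ge0 b)) ler_wpM2l.
Qed.

Lemma le_dconj (R : realType) (k : nat) (A : {fset 'cV[R]_k})
    (h1 h2 : 'cV[R]_k -> \bar R) (d : R) (y : 'cV[R]_k) :
  (forall x, x \in A -> (h2 x <= h1 x + d%:E)%E) ->
  (dconj A h1 y <= dconj A h2 y + d%:E)%E.
Proof.
move=> h21; rewrite {1}/dconj big_seq; apply: bigmax_le => [|x xA].
  exact: leNye.
apply: (@le_trans _ _ ((inner x y)%:E - h2 x + d%:E)%E).
  (* If [h2 x] is +oo, so is [h1 x], and the left side is -oo; if [h1 x] is -oo, so is [h2 x], and
     the right side is +oo. *)
  have := h21 x xA; case: (h1 x) => [r1| |]; case: (h2 x) => [r2| |] //= h.
  - by move: h; rewrite !lee_fin => ?; lra.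
  - exact: leey.
  - exact: leNye.
rewrite leeD2r//.
exact: (le_bigmax_seq _ _ xpredT (fun x => ((inner x y)%:E - h2 x)%E) xA).
Qed.

(* Equal infinities are sent to the same real number by [fine]. *)
Lemma fine_dist_le (R : realType) (e1 e2 : \bar R) (d : R) : 0 <= d ->
  (e1 <= e2 + d%:E)%E -> (e2 <= e1 + d%:E)%E -> `|fine e1 - fine e2| <= d.
Proof.
move: e1 e2 => [r1| |] [r2| |] //= d0; rewrite ?subrr ?normr0//.
by rewrite !lee_fin ler_distlC => ? ?; apply/andP; split; lra.
Qed.

Lemma le_epsd (R : realType) (n : nat) (X : set 'cV[R]_n)
    (Xd Wd : {fset 'cV[R]_n}) (p : Wd -> R) (gamma : R)
    (ext : (Xd -> R) -> ('cV[R]_n -> R)) (J1 J2 : Xd -> R) (d : R)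
    (x : 'cV[R]_n) :
  (forall w, 0 <= p w) -> \sum_(w : Wd) p w = 1 -> 0 <= gamma ->
  (forall x, X x -> ext J1 x <= ext J2 x + d) ->
  (epsd gamma X p ext J1 x <= epsd gamma X p ext J2 x + (gamma * d)%:E)%E.
Proof.
move=> p_ge0 p_sum gamma_ge0 ext12.
rewrite EFinM /epsd -muleDr ?fin_num_adde_defl// lee_wpmul2l ?lee_fin//.
(* Writing [d] as its own expectation reduces the claim to a comparison term by term. *)
have -> : d%:E = (\sum_(w : Wd) (p w)%:E * d%:E)%E.
  by under eq_bigr do rewrite -EFinM; rewrite sumEFin -mulr_suml p_sum mul1r.
rewrite -big_split/=; apply: lee_sum => w _.
rewrite -muleDr ?fin_num_adde_defl// lee_wpmul2l ?lee_fin//.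
(* Off [X] both sides are +oo. *)
rewrite /extend_pinfty; case: ifPn => // /set_mem Xw.
by rewrite -EFinD lee_fin ext12.
Qed.

Theorem theorem3p11 (R : realType) (n m : nat)
  (X : set 'cV[R]_n) (U : set 'cV[R]_m)
  (X_compact : compact X) (U_compact : compact U)
  (Wd : {fset 'cV[R]_n}) (p : Wd -> R)
  (p_bounds : forall w, 0 <= p w <= 1) (p_sum : \sum_(w : Wd) p w = 1)
  (gamma : R) (gamma_bounds : 0 < gamma < 1)
  (fs : 'cV[R]_n -> 'cV[R]_n) (fs_lipschitz : lipschitz fs)
  (B : 'M[R]_(n, m))
  (Cs : 'cV[R]_n -> R) (Cs_lipschitz : [lipschitz Cs x | x in X])
  (Ci : 'cV[R]_m -> R) (Ci_lipschitz : [lipschitz Ci u | u in U])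
  (Xd : {fset 'cV[R]_n}) (Xd_sub : forall x, x \in Xd -> X x)
  (Ud : {fset 'cV[R]_m}) (Ud_sub : forall u, u \in Ud -> U u)
  (admissible_nonempty :
    forall x, x \in Xd -> admissible_inputs fs B X Wd U x !=set0)
  (Yg Zg : @grid R n) (Vg : @grid R m)
  (ext : (Xd -> R) -> ('cV[R]_n -> R))
  (Zg_hull : forall x, x \in Xd ->
    convex_hull [set z | z \in grid_points Zg] (fs x))
  (ext_nonexpansive : forall J1 J2 : Xd -> R,
    (sup_norm X (ext J1 \- ext J2)%R <= sup_norm setT (J1 \- J2)%R)%E)
  (J1 J2 : Xd -> R) :
  (sup_norm setT (dCDP gamma fs B Cs Ci X Ud p ext Yg Zg Vg J1
                  \- dCDP gamma fs B Cs Ci X Ud p ext Yg Zg Vg J2)%R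
   <= gamma%:E * sup_norm setT (J1 \- J2)%R)%E.
Proof.
have /andP[g0 _] := gamma_bounds.
have p0 w : 0 <= p w by have /andP[] := p_bounds w.
apply: ge_ereal_sup => _ [x _ <-].
(* An infinite norm makes the bound trivial; -oo would be the supremum of an empty set, which the
   point [x] excludes. *)
case Nd : (sup_norm setT (J1 \- J2)%R) => [d| |]; last 2 first.
- by rewrite gt0_muley ?leey ?lte_fin.
- have : (`|(J1 \- J2)%R x|%:E <= sup_norm setT (J1 \- J2)%R)%E.
    by apply: ereal_sup_ubound; exists x.
  by rewrite Nd.
have d_ge0 : 0 <= d.
  rewrite -lee_fin -Nd; apply: (@le_trans _ _ `|(J1 \- J2)%R x|%:E).
    by rewrite lee_fin.
  by apply: ereal_sup_ubound; exists x.
have ext12 y : X y -> `|ext J1 y - ext J2 y| <= d.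
  move=> Xy; rewrite -lee_fin -Nd; apply: le_trans (ext_nonexpansive J1 J2).
  by apply: ereal_sup_ubound; exists y.
have gd_ge0 : 0 <= gamma * d by rewrite mulr_ge0// ltW.
rewrite -EFinM lee_fin /dCDP/= opprD addrACA subrr add0r.
apply: lerp_nonexpansive; first exact: Zg_hull (fsvalP x).
have ext1 y : X y -> ext J1 y <= ext J2 y + d.
  by move=> /ext12; rewrite ler_distl => /andP[].
have ext2 y : X y -> ext J2 y <= ext J1 y + d.
  by move=> /ext12; rewrite ler_distlC => /andP[].
(* The interpolated input cost is common to both sides. Each conjugation swaps [J1] and [J2], so
   after two of them the bound on [epsd] is needed in the original order. *)
move=> z; apply: fine_dist_le => //; apply: le_dconj => y _;
  rewrite /phid -addeA leeD2l//; apply: le_dconj => y' _;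
  by apply: le_epsd => //; exact: ltW.
Qed.
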